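(* Let $I, K \subseteq A$ and $J, L \subseteq B$ be ideals, and let $s\ge 1$ be an integer. Assume that $I^{s-1}\neq I^s$ and $J^{s-1}\neq J^s$. If $(I+J)^{(s)}_{KL} =(I+J)^s$ (as ideals of $R=A\otimes_{\Bbbk}B$), then $I^{(i)}_K =I^i$ and $J^{(i)}_L =J^i$ for all positive integers $i \leq s$.
   Context: Throughout, $\Bbbk$ is a field, and $A$ and $B$ are Noetherian commutative $\Bbbk$-algebras such that $R = A\otimes_{\Bbbk} B$ is also Noetherian. Ideals of $A$ and of $B$ are identified with their extensions to $R$: $I+J$ means $IR+JR$ and $KL$ means $(KR)(LR)$. The $0$-th power of an ideal is the whole ring. For ideals $\mathfrak{a},\mathfrak{c}$ in a commutative ring $S$ and an integer $s\ge 1$, the $s$-th saturated power of $\mathfrak{a}$ with respect to $\mathfrak{c}$ is $\mathfrak{a}^{(s)}_{\mathfrak{c}} := \mathfrak{a}^s : \mathfrak{c}^\infty = \bigcup_{t\ge 1} (\mathfrak{a}^s :_S \mathfrak{c}^t)$. *)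

(* Defs.v *)
From HB Require Import structures.
From mathcomp Require Import all_boot all_order all_algebra.
From mathcomp Require Import boolp classical_sets.

Set Implicit Arguments.
Unset Strict Implicit.
Unset Printing Implicit Defensive.

Import GRing.Theory.
Local Open Scope classical_set_scope.
Local Open Scope ring_scope.

(* Ideals are Prop-valued sets, possibly equal to the whole ring; MathComp's
   [idealr] is restricted to proper ideals with a boolean membership test. *)

Section Ideals.
Variable S : comNzRingType.
Implicit Types a c X : set S.

Definition is_ideal a : Prop :=
  [/\ a 0,
      forall x y, a x -> a y -> a (x + y) &
      forall r x, a x -> a (r * x)].

Definition ideal_gen X : set S := smallest is_ideal X.

Definition noetherian : Prop :=
  forall a, is_ideal a -> exists s : seq S, a = ideal_gen [set` s].

Definition ideal_add a c : set S := [set z | exists x y, [/\ a x, c y & z = x + y]].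

Definition ideal_mul a c : set S :=
  ideal_gen [set z | exists x y, [/\ a x, c y & z = x * y]].

(* [ideal_exp a 0] is the whole ring. *)
Definition ideal_exp a (n : nat) : set S := iter n (ideal_mul a) setT.

Definition ideal_colon a c : set S := [set x | forall y, c y -> a (x * y)].

Definition saturated_power a c (s : nat) : set S :=
  \bigcup_(t in [set t : nat | (1 <= t)%N])
     ideal_colon (ideal_exp a s) (ideal_exp c t).

End Ideals.

Arguments noetherian S : clear implicits.

Definition ideal_ext (S T : comNzRingType) (f : S -> T) (a : set S) : set T :=
  ideal_gen (f @` a).

(* [R], with the algebra morphisms [iA : a |-> a (x) 1] and
   [iB : b |-> 1 (x) b], is a tensor product of the k-algebras [A] and [B]:
   the map [(a, b) |-> iA a * iB b] is the universal k-bilinear map on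
   [A * B]. The multiplication of [R] is then the usual one, because [iA] and
   [iB] are morphisms of algebras. *)
Definition is_tensor_product (k : fieldType) (A B R : comAlgType k)
    (iA : {lrmorphism A -> R}) (iB : {lrmorphism B -> R}) : Prop :=
  forall (V : lmodType k) (beta : {bilinear A -> B -> V}),
    exists2 f : {linear R -> V},
      (forall x y, f (iA x * iB y) = beta x y) &
      forall g : {linear R -> V},
        (forall x y, g (iA x * iB y) = beta x y) -> g =1 f.

(* Main.v *)
Require Import Defs.
From HB Require Import structures.
From mathcomp Require Import all_boot all_order all_algebra.
From mathcomp Require Import boolp classical_sets.

(** Let [x * K^t] lie in [I^i], where [1 <= i <= s]. The powers of [J] decrease
    strictly up to exponent [s], so there is [y] in [J^(s-i)] outside
    [J^(s-i+1)]. Then [x * y] multiplies [(K L)^t] into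
    [I^i J^(s-i)], hence into [(I + J)^s], and the hypothesis puts [x * y]
    in [(I + J)^s]. This power is the sum of the [I^p J^q] with [p + q = s]; each
    of these terms has [p >= i] or [q >= s-i+1], so [x * y] lies in
    [I^i R + J^(s-i+1) R] (lemma [ideal_exp_add_ext_sub]).

    Over a field, a pure tensor [x (x) y] in [M R + N R] has [x] in [M] or [y] in
    [N] (lemma [tensor_separation]): otherwise take linear forms [phi] killing
    [M] and [psi] killing [N], with [phi x = psi y = 1] (they exist by Zorn's
    lemma, [linear_form_separation]). The form [phi (x) psi] on [R] kills [M R]
    and [N R] but not [x (x) y]. With [M = I^i] and [N = J^(s-i+1)] this gives
    [x] in [I^i]. The claim about [J] is the same one with the two factors
    exchanged. *)

Set Implicit Arguments.
Unset Strict Implicit.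
Unset Printing Implicit Defensive.

Import GRing.Theory.
Local Open Scope classical_set_scope.
Local Open Scope ring_scope.

(** * Ideals and their powers *)

Section IdealTheory.
Variable S : comNzRingType.
Implicit Types (a b c X Y : set S) (x y : S).

Lemma ideal_gen_is_ideal X : is_ideal (ideal_gen X).
Proof.
split; first by move=> a [] [].
- by move=> x y Xx Xy a [aI Xa]; case: (aI) => _ + _; apply; [apply: Xx|apply: Xy].
- by move=> r x Xx a [aI Xa]; case: (aI) => _ _; apply; apply: Xx.
Qed.

Lemma ideal_mulr a x r : is_ideal a -> a x -> a (x * r).
Proof. by case=> _ _ aM ax; rewrite mulrC; apply: aM. Qed.

Lemma ideal_exp_is_ideal a n : is_ideal (ideal_exp a n).
Proof. by case: n => [|n]; [split|apply: ideal_gen_is_ideal]. Qed.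

Lemma ideal_add_is_ideal a c :
  is_ideal a -> is_ideal c -> is_ideal (ideal_add a c).
Proof.
case=> a0 aD aM [c0 cD cM]; split.
- by exists 0, 0; rewrite addr0.
- move=> _ _ [x [y [ax cy ->]]] [x' [y' [ax' cy' ->]]].
  by exists (x + x'), (y + y'); split; [apply: aD|apply: cD|rewrite addrACA].
- move=> r _ [x [y [ax cy ->]]].
  by exists (r * x), (r * y); split; [apply: aM|apply: cM|rewrite mulrDr].
Qed.

Lemma ideal_colon1_is_ideal a x :
  is_ideal a -> is_ideal [set y | a (x * y)].
Proof.
case=> a0 aD aM; split => /=; first by rewrite mulr0.
- by move=> y z ay az; rewrite mulrDr; apply: aD.
- by move=> r y ay; rewrite mulrCA; apply: aM.
Qed.

(** Products of two generated ideals are controlled by products of generators. *)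
Lemma ideal_gen_mul_ind X Y c : is_ideal c ->
  (forall x y, X x -> Y y -> c (x * y)) ->
  forall x y, ideal_gen X x -> ideal_gen Y y -> c (x * y).
Proof.
move=> cI XYc x y Xx Yy.
suff /(_ _ Yy) : ideal_gen Y `<=` [set z | c (x * z)] by [].
apply: smallest_sub; first exact: ideal_colon1_is_ideal.
move=> z Yz /=; rewrite mulrC.
suff /(_ _ Xx) : ideal_gen X `<=` [set w | c (z * w)] by [].
apply: smallest_sub; first exact: ideal_colon1_is_ideal.
by move=> w Xw /=; rewrite mulrC; apply: XYc.
Qed.

Lemma ideal_mul_sub a b c : is_ideal c ->
  (forall x y, a x -> b y -> c (x * y)) -> ideal_mul a b `<=` c.
Proof.
move=> cI abc; apply: smallest_sub => // _ [x [y [ax bY ->]]].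
exact: abc.
Qed.

Lemma mem_ideal_mul a b x y : a x -> b y -> ideal_mul a b (x * y).
Proof. by move=> ax bY; apply: sub_gen_smallest; exists x, y. Qed.

Lemma ideal_addC a c : ideal_add a c = ideal_add c a.
Proof.
by apply/seteqP; split=> _ [x [y [ax cy ->]]]; exists y, x; rewrite addrC.
Qed.

Lemma ideal_mulC a c : ideal_mul a c = ideal_mul c a.
Proof.
suff H b d : ideal_mul b d `<=` ideal_mul d b by apply/seteqP; split; apply: H.
apply: ideal_mul_sub => [|x y bx dy]; first exact: ideal_gen_is_ideal.
by rewrite mulrC; apply: mem_ideal_mul.
Qed.

Lemma ideal_exp_decreasing a m n :
  (m <= n)%N -> ideal_exp a n `<=` ideal_exp a m.
Proof.
move=> /subnK <-; elim: (n - m)%N => [//|d IH].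
apply: subset_trans IH; apply: ideal_mul_sub; first exact: ideal_exp_is_ideal.
by move=> x y _; case: (ideal_exp_is_ideal a (d + m)) => _ _; apply.
Qed.

Lemma ideal_exp_stable a m n : ideal_exp a m = ideal_exp a m.+1 ->
  (m <= n)%N -> ideal_exp a n = ideal_exp a n.+1.
Proof.
move=> am /subnK <-; elim: (n - m)%N => [//|d IH].
by rewrite addSn /ideal_exp !iterS -/(ideal_exp _ _) {1}IH.
Qed.

Lemma mem_ideal_expD a m n x y :
  ideal_exp a m x -> ideal_exp a n y -> ideal_exp a (m + n) (x * y).
Proof.
move=> + ay; elim: m x => [|m IH] x ax.
  by case: (ideal_exp_is_ideal a n) => _ _; apply.
rewrite mulrC.
suff /(_ _ ax) : ideal_exp a m.+1 `<=` [set z | ideal_exp a (m + n).+1 (y * z)].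
  by [].
apply: ideal_mul_sub.
  by apply: ideal_colon1_is_ideal; apply: ideal_exp_is_ideal.
move=> u v au av /=; rewrite mulrCA; apply: mem_ideal_mul => //.
by rewrite mulrC; apply: IH.
Qed.

Lemma sub_saturated_power a c n : ideal_exp a n `<=` saturated_power a c n.
Proof.
move=> x ax; exists 1%N => // y _.
by apply: ideal_mulr => //; apply: ideal_exp_is_ideal.
Qed.

End IdealTheory.

Lemma ideal_exp_rmorph (S T : comNzRingType) (f : {rmorphism S -> T})
    (a : set S) (c : set T) n :
  (forall x, a x -> c (f x)) ->
  forall x, ideal_exp a n x -> ideal_exp c n (f x).
Proof.
move=> ac; elim: n => [//|n IH] x ax.
suff /(_ _ ax) : ideal_exp a n.+1 `<=` [set z | ideal_exp c n.+1 (f z)] by [].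
have [c0 cD cM] := ideal_exp_is_ideal c n.+1.
apply: ideal_mul_sub.
  split=> [|u v cu cv|r u cu] /=; first by rewrite rmorph0.
  - by rewrite rmorphD; apply: cD.
  - by rewrite rmorphM; apply: cM.
move=> u v au av /=; rewrite rmorphM; apply: mem_ideal_mul; first exact: ac.
exact: IH.
Qed.

Lemma mem_ideal_ext (S T : comNzRingType) (f : S -> T) (a : set S) x :
  a x -> ideal_ext f a (f x).
Proof. by move=> ax; apply: sub_gen_smallest; exists x. Qed.

(** * Sums and products of two extended ideals *)

Section TwoFactors.
Variables (S T R : comNzRingType).
Variables (f : {rmorphism S -> R}) (g : {rmorphism T -> R}).
Implicit Types (I K M : set S) (J L N : set T).

Local Notation "I +e J" := (ideal_add (ideal_ext f I) (ideal_ext g J))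
  (at level 50).
Local Notation "K *e L" := (ideal_mul (ideal_ext f K) (ideal_ext g L))
  (at level 40).

Lemma ideal_add_ext_is_ideal I J : is_ideal (I +e J).
Proof. by apply: ideal_add_is_ideal; apply: ideal_gen_is_ideal. Qed.

Lemma mem_ideal_add_extl I J x : I x -> (I +e J) (f x).
Proof.
move=> Ix; exists (f x), 0; rewrite addr0; split=> //; first exact: mem_ideal_ext.
by case: (ideal_gen_is_ideal (g @` J)).
Qed.

Lemma mem_ideal_add_extr I J y : J y -> (I +e J) (g y).
Proof.
move=> Jy; exists 0, (g y); rewrite add0r; split=> //; last exact: mem_ideal_ext.
by case: (ideal_gen_is_ideal (f @` I)).
Qed.

Lemma ideal_add_ext_sub I J (c : set R) : is_ideal c ->
  (forall x, I x -> c (f x)) -> (forall y, J y -> c (g y)) -> I +e J `<=` c.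
Proof.
move=> cI If Jg _ [u [v [uI vJ ->]]]; case: (cI) => _ cD _; apply: cD.
- suff : ideal_ext f I `<=` c by apply.
  by apply: smallest_sub => // _ [x Ix <-]; apply: If.
- suff : ideal_ext g J `<=` c by apply.
  by apply: smallest_sub => // _ [y Jy <-]; apply: Jg.
Qed.

(** The [n]-th power of [I + J] is contained in the sum of the [I^p J^q] with
    [p + q = n]. *)
Lemma ideal_exp_add_ext_gen I J n :
  ideal_exp (I +e J) n `<=`
  ideal_gen [set z | exists p q x y, [/\ (p + q)%N = n, ideal_exp I p x,
                                        ideal_exp J q y & z = f x * g y]].
Proof.
elim: n => [|n IH].
  move=> z _; rewrite -[z]mulr1.
  case: (ideal_gen_is_ideal [set z | exists p q x y, [/\ (p + q)%N = 0%N,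
    ideal_exp I p x, ideal_exp J q y & z = f x * g y]]) => _ _; apply.
  apply: sub_gen_smallest; exists 0%N, 0%N, 1, 1; split=> //.
  by rewrite !rmorph1 mulr1.
apply: ideal_mul_sub; first exact: ideal_gen_is_ideal.
set G := ideal_gen _; have GI : is_ideal G by apply: ideal_gen_is_ideal.
move=> u v uIJ /IH vG; rewrite mulrC; move: u uIJ.
apply: ideal_add_ext_sub; first exact: ideal_colon1_is_ideal.
- move=> x Ix /=; rewrite mulrC; move: v vG.
  apply: smallest_sub; first exact: ideal_colon1_is_ideal.
  move=> _ [p [q [x' [y [pq Ix' Jy ->]]]]] /=; apply: sub_gen_smallest.
  exists p.+1, q, (x * x'), y; rewrite addSn pq rmorphM mulrA; split=> //.
  exact: mem_ideal_mul.
- move=> y Jy /=; rewrite mulrC; move: v vG.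
  apply: smallest_sub; first exact: ideal_colon1_is_ideal.
  move=> _ [p [q [x [y' [pq Ix Jy' ->]]]]] /=; apply: sub_gen_smallest.
  exists p, q.+1, x, (y * y'); rewrite addnS pq rmorphM mulrCA; split=> //.
  exact: mem_ideal_mul.
Qed.

Lemma ideal_exp_add_ext_sub I J m n :
  ideal_exp (I +e J) (m + n) `<=` ideal_exp I m +e ideal_exp J n.+1.
Proof.
apply: (subset_trans (@ideal_exp_add_ext_gen _ _ _)).
have IJ := ideal_add_ext_is_ideal (ideal_exp I m) (ideal_exp J n.+1).
apply: smallest_sub => // _ [p [q [x [y [pq Ix Jy ->]]]]].
have [mp|pm] := leqP m p.
  apply: ideal_mulr => //; apply: mem_ideal_add_extl.
  exact: ideal_exp_decreasing Ix.
rewrite mulrC; apply: ideal_mulr => //; apply: mem_ideal_add_extr.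
apply: ideal_exp_decreasing Jy.
by rewrite -(ltn_add2l p) pq ltn_add2r.
Qed.

Lemma ideal_exp_mul_ext_gen K L t :
  ideal_exp (K *e L) t `<=`
  ideal_gen [set z | exists x y, [/\ ideal_exp K t x, ideal_exp L t y
                                   & z = f x * g y]].
Proof.
elim: t => [|t IH].
  move=> z _; rewrite -[z]mulr1.
  case: (ideal_gen_is_ideal [set z | exists x y, [/\ ideal_exp K 0 x,
    ideal_exp L 0 y & z = f x * g y]]) => _ _; apply.
  by apply: sub_gen_smallest; exists 1, 1; rewrite !rmorph1 mulr1.
apply: ideal_mul_sub; first exact: ideal_gen_is_ideal.
set G := ideal_gen _; have GI : is_ideal G by apply: ideal_gen_is_ideal.
move=> u v uKL /IH vG; rewrite mulrC; move: u uKL.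
apply: ideal_mul_sub; first exact: ideal_colon1_is_ideal.
apply: (@ideal_gen_mul_ind _ _ _ [set w | G (v * w)]); first exact: ideal_colon1_is_ideal.
move=> _ _ [x Kx <-] [y Ly <-] /=; rewrite mulrC; move: v vG.
apply: smallest_sub; first exact: ideal_colon1_is_ideal.
move=> _ [x' [y' [Kx' Ly' ->]]] /=; apply: sub_gen_smallest.
exists (x * x'), (y * y'); rewrite !rmorphM mulrACA.
by split=> //; apply: mem_ideal_mul.
Qed.

(** If [x] is in [I^m : K^oo] and [y] is in [J^n], then [x * y] is in
    [(I + J)^(m+n) : (K L)^oo]. *)
Lemma mem_saturated_power_add_ext I J K L m n x y :
  saturated_power I K m x -> ideal_exp J n y ->
  saturated_power (I +e J) (K *e L) (m + n) (f x * g y).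
Proof.
move=> [t t_ge1 xKt] Jy; exists t => // z /ideal_exp_mul_ext_gen; move: z.
apply: smallest_sub.
  by apply: ideal_colon1_is_ideal; apply: ideal_exp_is_ideal.
move=> _ [a [b [Ka Lb ->]]] /=; rewrite mulrACA -!rmorphM.
apply: mem_ideal_expD.
- apply: (@ideal_exp_rmorph _ _ f I) (xKt _ Ka) => w.
  exact: mem_ideal_add_extl.
- apply: (@ideal_exp_rmorph _ _ g J); first by move=> w; exact: mem_ideal_add_extr.
  by apply: ideal_mulr => //; apply: ideal_exp_is_ideal.
Qed.

Lemma saturated_power_of_add_ext I J K L s :
  (forall M N x y, is_ideal M -> is_ideal N -> (M +e N) (f x * g y) ->
     M x \/ N y) ->
  ideal_exp J s.-1 <> ideal_exp J s ->
  saturated_power (I +e J) (K *e L) s = ideal_exp (I +e J) s ->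
  forall i, (1 <= i <= s)%N -> saturated_power I K i = ideal_exp I i.
Proof.
move=> sep powJ satIJ i /andP[i_ge1 i_le_s].
apply/seteqP; split; last exact: sub_saturated_power.
move=> x Ix.
have [y [Jy nJy]] :
    exists y, ideal_exp J (s - i) y /\ ~ ideal_exp J (s - i).+1 y.
  apply: contrapT => noy; apply: powJ.
  have JE : ideal_exp J (s - i) = ideal_exp J (s - i).+1.
    apply/seteqP; split; last by apply: ideal_exp_decreasing.
    by move=> y Jy; apply: contrapT => nJy; apply: noy; exists y.
  have s_gt0 : (0 < s)%N by apply: leq_trans i_le_s.
  rewrite -[in RHS](prednK s_gt0); apply: ideal_exp_stable JE _.
  by rewrite -subn1 leq_sub2l.
have : ideal_exp (I +e J) (i + (s - i)) (f x * g y).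
  rewrite subnKC // -satIJ -{1}(subnKC i_le_s).
  exact: mem_saturated_power_add_ext.
move=> /ideal_exp_add_ext_sub /sep[]; try exact: ideal_exp_is_ideal; by [].
Qed.

End TwoFactors.

(** * Separation by linear forms *)

(** Over a field, a vector outside a subspace is separated from it by a linear
    form. *)
Lemma linear_form_separation (k : fieldType) (V : lmodType k) (M : set V)
    (x : V) :
  M 0 -> (forall c u v, M u -> M v -> M (c *: u + v)) -> ~ M x ->
  exists phi : {linear V -> k^o}, phi x = 1 /\ forall m, M m -> phi m = 0.
Proof.
move=> M0 Mlin nMx.
(* The empty set is admitted because the union of the empty chain must be. *)
pose P W := [/\ forall c u v, W u -> W v -> W (c *: u + v),
                forall w, W w -> M `<=` W & ~ W x].
have [F FP totF|H [[Hlin HM nHx] maxH]] := @Zorn_bigcup _ P.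
  split.
  - move=> c u v [X FX Xu] [Y FY Yv].
    case: (totF _ _ FX FY) => sXY.
    + by exists Y => //; case: (FP _ FY) => Ylin _ _; apply: Ylin => //; apply: sXY.
    + by exists X => //; case: (FP _ FX) => Xlin _ _; apply: Xlin => //; apply: sXY.
  - move=> w [X FX Xw] m Mm; exists X => //.
    by case: (FP _ FX) => _ XM _; exact: (XM w Xw).
  - by move=> [X FX Xx]; case: (FP _ FX).
have H0 : H 0.
  apply: contrapT => nH0; apply: (maxH M); last by split=> // w _ m.
  split; last by move=> /(_ _ M0).
  by move=> w Hw; case: nH0; exact: (HM w Hw).
have MH : M `<=` H by exact: (HM 0).
have HZ c u : H u -> H (c *: u) by move=> Hu; rewrite -[_ *: _]addr0; apply: Hlin.
have HB u v : H u -> H v -> H (u - v).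
  by move=> Hu Hv; rewrite -scaleN1r addrC; apply: Hlin.
(* By maximality, [H] and [x] span the whole space. *)
have spanHx a : exists c, H (a - c *: x).
  apply: contrapT => nspan.
  have nHa : ~ H a by move=> Ha; apply: nspan; exists 0; rewrite scale0r subr0.
  pose W := [set w | exists c, H (w - c *: a)].
  have HW : H `<=` W by move=> h Hh; exists 0; rewrite scale0r subr0.
  apply: (maxH W).
    split=> // /(_ a) WH; apply: nHa; apply: WH.
    by exists 1; rewrite scale1r subrr.
  split.
  - move=> c u v [d Hd] [e He]; exists (c * d + e).
    rewrite scalerDl -scalerA opprD addrACA -scalerBr.
    exact: Hlin.
  - by move=> _ _; apply: subset_trans HW.
  - move=> [c Hc]; have [c0|c_neq0] := eqVneq c 0.
      by move: Hc; rewrite c0 scale0r subr0.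
    apply: nspan; exists c^-1.
    have := HZ (- c^-1) _ Hc.
    by rewrite scalerBr scalerA !scaleNr mulNr mulVf // scaleN1r opprK addrC.
have [phi phiE] := choice spanHx.
have phi_uniq a c : H (a - c *: x) -> phi a = c.
  move=> Hc; apply/eqP; rewrite -subr_eq0; apply: contrapT => /negP d_neq0.
  apply: nHx; have := HZ (phi a - c)^-1 _ (HB _ _ Hc (phiE a)).
  by rewrite opprB [_ + (_ - a)]addrC addrA subrK -scalerBl scalerA mulVf ?scale1r.
have phi_lin : linear (phi : V -> k^o).
  move=> c u v; apply: phi_uniq.
  rewrite -[c *: (phi u : k^o)]/(c * phi u) scalerDl -scalerA opprD addrACA -scalerBr.
  by apply: Hlin; apply: phiE.
pose philin := GRing.isLinear.Build k V k^o *:%R phi phi_lin.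
pose Phi : {linear V -> k^o} := HB.pack (phi : V -> k^o) philin.
exists Phi; split; first by apply: phi_uniq; rewrite scale1r subrr.
by move=> m Mm; apply: phi_uniq; rewrite scale0r subr0; apply: MH.
Qed.

Lemma ideal_linear (k : fieldType) (A : comAlgType k) (M : set A) :
  is_ideal M -> forall c u v, M u -> M v -> M (c *: u + v).
Proof.
case=> _ MD MM c u v Mu Mv; apply: MD => //.
by rewrite -[u]mul1r scalerAl; apply: MM.
Qed.

Section Tensor.
Variables (k : fieldType) (A B R : comAlgType k).
Variables (iA : {lrmorphism A -> R}) (iB : {lrmorphism B -> R}).
Hypothesis tensR : is_tensor_product iA iB.

Lemma tensor_form (phi : {linear A -> k^o}) (psi : {linear B -> k^o}) :
  exists f : {linear R -> k^o}, forall x y, f (iA x * iB y) = phi x * psi y.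
Proof.
pose beta (x : A) (y : B) : k^o := phi x * psi y.
have beta_bilin : bilinear_for *:%R *:%R beta.
  split=> [y c u v|x c u v]; rewrite /beta linearP.
  - by rewrite mulrDl -[c *: phi u]/(c * phi u) -mulrA.
  - by rewrite mulrDr -[c *: psi u]/(c * psi u) mulrCA.
pose betaB := bilinear_isBilinear.Build k A B k^o *:%R *:%R beta beta_bilin.
pose Beta : {bilinear A -> B -> k^o} := HB.pack beta betaB.
by have [f fE _] := tensR Beta; exists f.
Qed.

(** Pure tensors span [R]. *)
Lemma tensor_form_eq0 (h : {linear R -> k^o}) :
  (forall x y, h (iA x * iB y) = 0) -> forall r, h r = 0.
Proof.
move=> h0 r; pose beta (x : A) (y : B) : k^o := 0.
have beta_bilin : bilinear_for *:%R *:%R beta.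
  by split=> [y c u v|x c u v]; rewrite /beta /= scaler0 addr0.
pose betaB := bilinear_isBilinear.Build k A B k^o *:%R *:%R beta beta_bilin.
pose Beta : {bilinear A -> B -> k^o} := HB.pack beta betaB.
have [f _ f_uniq] := tensR Beta.
have -> : h r = f r by apply: f_uniq.
by rewrite -(f_uniq (\0 : {linear R -> k^o})).
Qed.

Lemma tensor_form_mul_eq0 (f : {linear R -> k^o}) (z : R) :
  (forall x y, f (iA x * iB y * z) = 0) -> forall r, f (r * z) = 0.
Proof.
move=> f0.
have flin : linear ((fun r => f (r * z)) : R -> k^o).
  by move=> c u v; rewrite mulrDl -scalerAl linearP.
pose hlin := GRing.isLinear.Build k R k^o *:%R _ flin.
pose h : {linear R -> k^o} := HB.pack ((fun r => f (r * z)) : R -> k^o) hlin.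
exact: (@tensor_form_eq0 h).
Qed.

(** Equivalently, the tensor product of nonzero vectors of [A / M] and [B / N]
    is nonzero. *)
Lemma tensor_separation (M : set A) (N : set B) x y :
  is_ideal M -> is_ideal N ->
  ideal_add (ideal_ext iA M) (ideal_ext iB N) (iA x * iB y) -> M x \/ N y.
Proof.
move=> MI NI MNxy; have [Mx|nMx] := pselect (M x); first by left.
right; apply: contrapT => nNy.
have [M0 _ MM] := MI; have [N0 _ NM] := NI.
have [phi [phix phiM]] := linear_form_separation M0 (ideal_linear MI) nMx.
have [psi [psiy psiN]] := linear_form_separation N0 (ideal_linear NI) nNy.
have [f fE] := tensor_form phi psi.
(* The largest ideal in the kernel of [f] contains [M R] and [N R]. *)
have /(_ _ MNxy 1) : ideal_add (ideal_ext iA M) (ideal_ext iB N) `<=`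
    [set z | forall r, f (r * z) = 0].
  apply: ideal_add_ext_sub.
  - split=> [r|u v fu fv r|c u fu r] /=; first by rewrite mulr0 linear0.
    + by rewrite mulrDr linearD fu fv addr0.
    + by rewrite mulrA.
  - move=> m Mm; apply: tensor_form_mul_eq0 => a b.
    by rewrite mulrAC -rmorphM fE phiM ?mul0r //; apply: MM.
  - move=> n Nn; apply: tensor_form_mul_eq0 => a b.
    by rewrite -mulrA -rmorphM fE psiN ?mulr0 //; apply: NM.
by rewrite mul1r fE phix psiy mulr1 => /eqP; rewrite oner_eq0.
Qed.

End Tensor.

(** * Saturated powers in the two factors *)

Theorem theorem3p9 (k : fieldType) (A B R : comAlgType k)
    (iA : {lrmorphism A -> R}) (iB : {lrmorphism B -> R})
    (noethA : noetherian A) (noethB : noetherian B) (noethR : noetherian R)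
    (tensR : is_tensor_product iA iB)
    (I K : set A) (J L : set B)
    (idI : is_ideal I) (idK : is_ideal K) (idJ : is_ideal J) (idL : is_ideal L)
    (s : nat) (s_ge1 : (1 <= s)%N)
    (powI : ideal_exp I s.-1 <> ideal_exp I s)
    (powJ : ideal_exp J s.-1 <> ideal_exp J s)
    (satIJ :
       saturated_power (ideal_add (ideal_ext iA I) (ideal_ext iB J))
         (ideal_mul (ideal_ext iA K) (ideal_ext iB L)) s
       = ideal_exp (ideal_add (ideal_ext iA I) (ideal_ext iB J)) s) :
  forall i : nat, (1 <= i <= s)%N ->
    saturated_power I K i = ideal_exp I i /\
    saturated_power J L i = ideal_exp J i.
Proof.
move=> i i_s; split.
  exact: (saturated_power_of_add_ext (tensor_separation tensR) powJ satIJ).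
apply: (@saturated_power_of_add_ext _ _ _ iB iA J I L K s _ powI _ i i_s).
- move=> N M y x NI MI; rewrite ideal_addC mulrC => /(tensor_separation tensR).
  by case=> //; [right|left].
- by rewrite ideal_addC ideal_mulC.
Qed.
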